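(* Let $(S,d)$ be an asymmetric $k$-center instance with optimal radius $r^*$ and optimal clustering $\{C_1,\dots,C_k\}$, let $\alpha\ge1$, and let $\mathcal{C}$ be the clustering induced by a set of $k$ centers whose $k$-center cost is at most $\alpha r^*$. Then every optimal cluster that is $\alpha$-locally perturbation resilient is a cluster of $\mathcal{C}$; moreover this holds even for every optimal cluster that merely satisfies $\alpha$-local metric perturbation resilience.
   Context: An asymmetric $k$-center instance is a finite set $S$ with $d:S\times S\to\mathbb{R}_{\ge0}$ satisfying the metric axioms except symmetry (in particular the directed triangle inequality $d(u,w)\le d(u,v)+d(v,w)$); this includes ordinary symmetric $k$-center. For $X\subseteq S$ with $|X|=k$, the cost is $\max_{v\in S}\min_{x\in X}d(x,v)$, $r^*$ is the minimum cost, and the clustering induced by $X$ assigns each $v$ to the center $x\in X$ minimizing $d(x,v)$. For $\alpha\ge1$, an $\alpha$-perturbation of $d$ is any $d'$ with $d(u,v)\le d'(u,v)\le\alpha d(u,v)$ for all $u,v$; it is an $\alpha$-metric perturbation if in addition $d'$ satisfies the (directed) triangle inequality. An optimal cluster $C_i$ is $\alpha$-locally perturbation resilient (resp. $\alpha$-locally metric perturbation resilient) if for every $\alpha$-perturbation (resp. every $\alpha$-metric perturbation) $d'$, the optimal $k$-center clustering under $d'$ contains $C_i$ as one of its clusters. *)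

(* Defs.v *)
From mathcomp Require Import all_boot all_order all_algebra.
From mathcomp Require Import reals.

Set Implicit Arguments.
Unset Strict Implicit.
Unset Printing Implicit Defensive.

Import Order.TTheory GRing.Theory Num.Theory.
Local Open Scope ring_scope.

Section AsymmetricKCenter.
Variables (R : realType) (S : finType).
Implicit Types (d : S -> S -> R) (X A : {set S}) (P : {set {set S}}).

Definition triangle_ineq d := forall u v w, d u w <= d u v + d v w.

Record asymmetric_metric d : Prop := AsymmetricMetric {
  asym_ge0 : forall u v, 0 <= d u v;
  asym_eq0 : forall u v, d u v = 0 <-> u = v;
  asym_triangle : triangle_ineq d }.

(* The default value of the minimum bounds every [d x v] from above, so it    *)
(* plays no role as soon as [X] is nonempty; see [dist_from_attained].        *)
Definition dist_from d X (v : S) : R :=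
  \big[Num.min / \big[Num.max/0]_(u : S) d u v]_(x in X) d x v.

(* The distance functions considered are nonnegative, hence the default 0. *)
Definition cost d X : R := \big[Num.max/0]_(v : S) dist_from d X v.

Definition optimal_centers d (k : nat) X :=
  #|X| = k /\ forall Y : {set S}, #|Y| = k -> cost d X <= cost d Y.

Definition optimal_radius d (k : nat) (r : R) :=
  exists2 X, optimal_centers d k X & cost d X = r.

(* A center set may induce several clusterings, as ties between equally close *)
(* centers may be broken arbitrarily: [f] maps each point to its center.      *)
Definition nearest_center d X (f : S -> S) :=
  forall v, f v \in X /\ forall x, x \in X -> d (f v) v <= d x v.

Definition induced_clustering d X P :=
  exists2 f, nearest_center d X f & P = [set [set v | f v == x] | x in X].

Definition optimal_clustering d (k : nat) P :=
  exists2 X, optimal_centers d k X & induced_clustering d X P.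

Definition perturbation (alpha : R) d (d' : S -> S -> R) :=
  forall u v, d u v <= d' u v <= alpha * d u v.

Definition metric_perturbation (alpha : R) d (d' : S -> S -> R) :=
  perturbation alpha d d' /\ triangle_ineq d'.

(* When the optimal clustering under [d'] is not unique, every one of them is *)
(* required to contain the cluster.                                           *)
Definition locally_resilient (alpha : R) d (k : nat) A :=
  forall d', perturbation alpha d d' ->
  forall P, optimal_clustering d' k P -> A \in P.

Definition locally_metric_resilient (alpha : R) d (k : nat) A :=
  forall d', metric_perturbation alpha d d' ->
  forall P, optimal_clustering d' k P -> A \in P.

Lemma dist_from_attained d X v : X != set0 ->
  exists2 x, x \in X &
    dist_from d X v = d x v /\ forall y, y \in X -> d x v <= d y v.
Proof.
case/set0Pn => x0 x0X; case: (arg_minP (fun x => d x v) x0X) => x xX xmin.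
exists x => //; split => //; apply/le_anti/andP; split.
  exact: bigmin_le_cond.
by apply/bigmin_geP; split=> [|y /xmin//]; apply: le_bigmax.
Qed.

End AsymmetricKCenter.

(* Main.v *)
(** Compose [d] with the profile [g t = max t (min (alpha t) (alpha r))], where
    [r] is the optimal radius.  As [g] is nondecreasing and subadditive, the
    result is an [alpha]-metric perturbation of [d], nearest centers for [d]
    remain nearest, and the new cost of a center set is the image by [g] of its
    old cost.  Since [g] is constant on [[r, alpha r]], every center set of cost
    at most [alpha r] becomes optimal, so its clustering contains each locally
    resilient cluster. *)
Require Import Defs.
From mathcomp Require Import all_boot all_order all_algebra.
From mathcomp Require Import reals.

Set Implicit Arguments.
Unset Strict Implicit.
Unset Printing Implicit Defensive.

Import Order.TTheory GRing.Theory Num.Theory.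
Local Open Scope ring_scope.

Section HomoMinMax.
Context {disp disp' : Order.disp_t} {T : orderType disp} {T' : orderType disp'}.
Variable g : T -> T'.
Hypothesis g_homo : {homo g : x y / (x <= y)%O}.

Lemma homo_max : {morph g : x y / Order.max x y}.
Proof.
by move=> x y; case: leP => [|/ltW] /g_homo gxy; [rewrite max_r|rewrite max_l].
Qed.

Lemma homo_min : {morph g : x y / Order.min x y}.
Proof.
by move=> x y; case: leP => [|/ltW] /g_homo gxy; [rewrite min_l|rewrite min_r].
Qed.

End HomoMinMax.

Definition nneg_subadditive (R : numDomainType) (g : R -> R) :=
  {in Num.nneg &, forall x y, g (x + y) <= g x + g y}.

Section Subadditive.
Variable R : realDomainType.
Implicit Types g h : R -> R.

Lemma nneg_subadditive_max g h :
  nneg_subadditive g -> nneg_subadditive h ->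
  nneg_subadditive (fun t => Num.max (g t) (h t)).
Proof.
move=> g_sub h_sub x y x0 y0; rewrite ge_max (le_trans (g_sub x y x0 y0)) /=.
  by rewrite (le_trans (h_sub x y x0 y0)) // lerD // le_max lexx orbT.
by rewrite lerD // le_max lexx.
Qed.

Lemma nneg_subadditive_min_cst g m :
  {in Num.nneg, forall t, 0 <= g t} -> 0 <= m ->
  nneg_subadditive g -> nneg_subadditive (fun t => Num.min (g t) m).
Proof.
move=> g_ge0 m0 g_sub x y x0 y0; have [gx0 gy0] := (g_ge0 x x0, g_ge0 y y0).
rewrite ge_min; case: (leP (g x) m) => _.
  by case: (leP (g y) m) => _; rewrite ?g_sub // lerDr gx0 orbT.
by rewrite lerDl le_min gy0 m0 orbT.
Qed.

End Subadditive.

Section Plateau.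
Variable R : realDomainType.
Implicit Types alpha r t : R.

Definition plateau alpha r t : R :=
  Num.max t (Num.min (alpha * t) (alpha * r)).

Lemma plateau_homo alpha r :
  0 <= alpha -> {homo plateau alpha r : x y / x <= y}.
Proof.
by move=> alpha0 x y xy; rewrite /plateau le_max2 // le_min2 // ler_wpM2l.
Qed.

Lemma plateau0 alpha r : 0 <= alpha -> 0 <= r -> plateau alpha r 0 = 0.
Proof. by move=> ? ?; rewrite /plateau mulr0 min_l ?maxxx // mulr_ge0. Qed.

Lemma plateau_const alpha r t :
  0 <= alpha -> r <= t <= alpha * r -> plateau alpha r t = alpha * r.
Proof.
by move=> alpha0 /andP[rt tar]; rewrite /plateau min_r ?max_r ?ler_wpM2l.
Qed.

Lemma plateau_bounds alpha r t :
  1 <= alpha -> 0 <= t -> t <= plateau alpha r t <= alpha * t.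
Proof.
by move=> alpha1 t0; rewrite /plateau le_max lexx ge_max ge_min lexx ler_peMl.
Qed.

Lemma plateau_subadditive alpha r :
  0 <= alpha -> 0 <= r -> nneg_subadditive (plateau alpha r).
Proof.
move=> alpha0 r0; apply: nneg_subadditive_max => //.
by apply: nneg_subadditive_min_cst => [t t0||x y _ _];
  rewrite ?mulr_ge0 ?mulrDr.
Qed.

End Plateau.

Section DistanceTransform.
Variables (R : realType) (S : finType) (d : S -> S -> R) (g : R -> R).
Implicit Types (X : {set S}) (P : {set {set S}}).

Definition dist_transform u v : R := g (d u v).

Hypothesis g_homo : {homo g : x y / x <= y}.

Lemma metric_perturbation_transform alpha :
  (forall u v, 0 <= d u v) -> triangle_ineq d -> nneg_subadditive g ->
  {in Num.nneg, forall t, t <= g t <= alpha * t} ->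
  metric_perturbation alpha d dist_transform.
Proof.
move=> d_ge0 d_tri g_sub g_bounds.
split=> [u v|u v w]; first exact/g_bounds/d_ge0.
by apply: le_trans (g_sub _ _ (d_ge0 u v) (d_ge0 v w)); apply: g_homo.
Qed.

Lemma nearest_center_transform X f :
  nearest_center d X f -> nearest_center dist_transform X f.
Proof.
by move=> near v; have [fvX fmin] := near v; split=> // x /fmin; apply: g_homo.
Qed.

Lemma induced_clustering_transform X P :
  induced_clustering d X P -> induced_clustering dist_transform X P.
Proof. by case=> f /nearest_center_transform; exists f. Qed.

(* The empty maxima in [dist_from] and [cost] are 0. *)
Hypothesis g0 : g 0 = 0.

Lemma dist_from_transform X v :
  dist_from dist_transform X v = g (dist_from d X v).
Proof.
by rewrite /dist_from (big_morph g (homo_min g_homo) erefl)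
           (big_morph g (homo_max g_homo) g0).
Qed.

Lemma cost_transform X : cost dist_transform X = g (cost d X).
Proof.
rewrite /cost (big_morph g (homo_max g_homo) g0).
by apply: eq_bigr => v _; rewrite dist_from_transform.
Qed.

Lemma optimal_centers_transform k r X :
  optimal_radius d k r -> #|X| = k -> g (cost d X) = g r ->
  optimal_centers dist_transform k X.
Proof.
move=> [X0 [_ X0min] <-] Xk gX; split=> // Y /X0min X0Y.
by rewrite !cost_transform gX g_homo.
Qed.

End DistanceTransform.

Section OptimalRadius.
Variables (R : realType) (S : finType) (d : S -> S -> R) (k : nat) (r : R).
Implicit Types (X : {set S}) (P : {set {set S}}).
Hypothesis d_radius : optimal_radius d k r.

Lemma optimal_radius_ge0 : 0 <= r.
Proof. by case: d_radius => X _ <-; apply: bigmax_ge_id. Qed.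

Lemma optimal_radius_le_cost X : #|X| = k -> r <= cost d X.
Proof. by case: d_radius => X0 [_ X0min] <-; apply: X0min. Qed.

Lemma approx_clustering_optimal_perturbation alpha X P :
  asymmetric_metric d -> 1 <= alpha -> #|X| = k -> cost d X <= alpha * r ->
  induced_clustering d X P ->
  exists2 d', metric_perturbation alpha d d' & optimal_clustering d' k P.
Proof.
move=> [d_ge0 _ d_tri] alpha1 Xk Xcost dXP.
have alpha0 : 0 <= alpha := le_trans ler01 alpha1.
have r0 := optimal_radius_ge0; have rX := optimal_radius_le_cost Xk.
have g_homo := plateau_homo r alpha0.
exists (dist_transform d (plateau alpha r)).
  apply: metric_perturbation_transform => // [|t]; last exact: plateau_bounds.
  exact: plateau_subadditive.
exists X; last exact: induced_clustering_transform.
apply: (optimal_centers_transform g_homo (plateau0 alpha0 r0) d_radius Xk).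
by rewrite !plateau_const ?lexx ?rX ?(le_trans rX).
Qed.

End OptimalRadius.

Lemma locally_resilient_metric (R : realType) (S : finType) alpha
    (d : S -> S -> R) k A :
  locally_resilient alpha d k A -> locally_metric_resilient alpha d k A.
Proof. by move=> resA d' [dd' _]; apply: resA. Qed.

Theorem theorem2 (R : realType) (S : finType) (d : S -> S -> R) (k : nat)
    (hd : asymmetric_metric d) (hk : (0 < k)%N)
    (rstar : R) (hr : optimal_radius d k rstar)
    (Copt : {set {set S}}) (hCopt : optimal_clustering d k Copt)
    (alpha : R) (halpha : 1 <= alpha)
    (X : {set S}) (hXk : #|X| = k) (hX : cost d X <= alpha * rstar)
    (C : {set {set S}}) (hC : induced_clustering d X C) :
  (forall A : {set S}, A \in Copt -> locally_resilient alpha d k A -> A \in C)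
  /\
  (forall A : {set S}, A \in Copt ->
     locally_metric_resilient alpha d k A -> A \in C).
Proof.
have [d' dd' C_opt] :=
  approx_clustering_optimal_perturbation hr hd halpha hXk hX hC.
have metric_case A : locally_metric_resilient alpha d k A -> A \in C.
  by move=> resA; apply: resA dd' C C_opt.
split=> A _ => [/locally_resilient_metric|]; exact: metric_case.
Qed.
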